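(* Let $d\ge1$ be an integer, let $p=(p_0,\dots,p_d)\in\mathcal{D}_d$, and let $X=(X_1,\dots,X_d)\in\mathcal{P}(p)$. Then for any subset $\{j_1,\dots,j_k\}\subseteq\{1,\dots,d\}$ of $k\ge1$ distinct indices, $$p_d\le E[X_{j_1}\cdots X_{j_k}]\le\sum_{h=k}^dp_h,$$ and the bounds are sharp, i.e. each of the two bounds is attained by some element of $\mathcal{P}(p)$.
   Context: $\mathcal{D}_d$ is the simplex of probability mass functions $p=(p_0,\dots,p_d)$ on $\{0,\dots,d\}$. $\mathcal{P}(p)$ is the set of probability mass functions $f$ on $\{0,1\}^d$ such that, if $X=(X_1,\dots,X_d)$ has probability mass function $f$, then $\sum_{i=1}^dX_i$ has probability mass function $p$. Random vectors are identified with their distributions: $X\in\mathcal{P}(p)$ means that the probability mass function of $X$ lies in $\mathcal{P}(p)$. *)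

(* Defs.v *)
From mathcomp Require Import all_boot all_order all_algebra.

Set Implicit Arguments.
Unset Strict Implicit.
Unset Printing Implicit Defensive.

Import Order.TTheory GRing.Theory Num.Theory.
Local Open Scope ring_scope.

Definition is_pmf (R : realFieldType) (T : finType) (f : {ffun T -> R}) : Prop :=
  (forall x, 0 <= f x) /\ \sum_x f x = 1.

(* {0,1}^d, with bool as {0,1}; a coordinate is used as a number through the
   coercion of bool to nat. *)
Definition binvec (d : nat) : finType := {ffun 'I_d -> bool}.

Definition coord_sum (d : nat) (x : binvec d) : nat := (\sum_(i < d) x i)%N.

Definition prob (R : realFieldType) (T : finType) (f : {ffun T -> R})
    (A : pred T) : R := \sum_(x | A x) f x.

Definition expect (R : realFieldType) (T : finType) (f : {ffun T -> R})
    (g : T -> R) : R := \sum_x f x * g x.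

(* A random vector is identified with its probability mass function f, so
   this is the class P(p). *)
Definition in_class (R : realFieldType) (d : nat) (p : {ffun 'I_d.+1 -> R})
    (f : {ffun binvec d -> R}) : Prop :=
  is_pmf f /\
  forall h : 'I_d.+1, prob f [pred x | coord_sum x == h :> nat] = p h.

Definition cross_moment (R : realFieldType) (d : nat)
    (f : {ffun binvec d -> R}) (J : {set 'I_d}) : R :=
  expect f (fun x => \prod_(j in J) (x j : nat)%:R).

(* Main.v *)
(* Writing S for the support of X, the moment is P(J \subset S), and
   {#|S| = d} \subset {J \subset S} \subset {#|S| >= #|J|}.
   Both bounds are attained by a law charging, for each h, a single set of size
   h: one containing J whenever h >= #|J| for the upper bound, one avoiding a
   fixed element of J whenever h < d for the lower bound. *)

Require Import Defs.
From mathcomp Require Import all_boot all_order all_algebra.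

Set Implicit Arguments.
Unset Strict Implicit.
Unset Printing Implicit Defensive.

Import Order.TTheory GRing.Theory Num.Theory.
Local Open Scope ring_scope.

Definition support_set (d : nat) (x : binvec d) : {set 'I_d} :=
  [set i | x i].

Lemma coord_sum_card (d : nat) (x : binvec d) :
  coord_sum x = #|support_set x|.
Proof.
rewrite /coord_sum -sum1_card [RHS]big_mkcond /=.
by apply: eq_bigr => i _; rewrite inE; case: (x i).
Qed.

Lemma support_set_indicator (d : nat) (B : {set 'I_d}) :
  support_set [ffun i => i \in B] = B.
Proof. by apply/setP => i; rewrite inE ffunE. Qed.

Lemma prod_indicator (R : realFieldType) (d : nat) (x : binvec d)
    (J : {set 'I_d}) :
  \prod_(j in J) (x j : nat)%:R = (J \subset support_set x)%:R :> R.
Proof.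
have [/subsetP sub|/subsetPn [j jJ]] := boolP (J \subset support_set x).
  by apply: big1 => j /sub; rewrite inE => ->.
by rewrite inE (bigD1 j) //= => /negbTE ->; rewrite mul0r.
Qed.

Lemma cross_moment_prob (R : realFieldType) (d : nat)
    (f : {ffun binvec d -> R}) (J : {set 'I_d}) :
  cross_moment f J = prob f [pred x | J \subset support_set x].
Proof.
rewrite /cross_moment /expect /prob [RHS]big_mkcond /=.
by apply: eq_bigr => x _; rewrite prod_indicator mulr_natr mulrb.
Qed.

Lemma prob_le (R : realFieldType) (T : finType) (f : {ffun T -> R})
    (A B : pred T) :
  (forall x, 0 <= f x) -> (forall x, A x -> B x) -> prob f A <= prob f B.
Proof.
move=> f0 AB; rewrite /prob [leLHS]big_mkcond [leRHS]big_mkcond /=.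
apply: ler_sum => x _; case: ifP => [/AB -> //|_].
by case: ifP.
Qed.

(** Splitting the event by the value of the coordinate sum, which never exceeds [d], leaves the
    level sets whose masses [in_class] prescribes. *)
Lemma prob_coord_sum (R : realFieldType) (d : nat) (p : {ffun 'I_d.+1 -> R})
    (f : {ffun binvec d -> R}) (A : pred nat) :
  in_class p f ->
  prob f [pred x | A (coord_sum x)] = \sum_(h < d.+1 | A h) p h.
Proof.
move=> [_ fp].
have lt_d (x : binvec d) : (coord_sum x < d.+1)%N.
  by rewrite ltnS coord_sum_card (leq_trans (max_card _)) ?card_ord.
rewrite /prob (partition_big (fun x => Ordinal (lt_d x)) A) //=.
apply: eq_bigr => h Ah; rewrite -fp; apply: eq_bigl => x /=.
by rewrite -val_eqE /=; case: eqP => [->|]; rewrite ?Ah ?andbF.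
Qed.

Lemma subset_of_card (T : finType) (A : {set T}) (n : nat) :
  (n <= #|A|)%N -> exists2 B : {set T}, B \subset A & #|B| = n.
Proof.
move=> nA; exists [set x in take n (enum A)].
  by apply/subsetP => x; rewrite inE => /mem_take; rewrite mem_enum.
rewrite cardsE (card_uniqP _) ?take_uniq ?enum_uniq //.
by rewrite size_takel // -cardE.
Qed.

(** Serves the lower bound: a set missing one fixed [j] of the nonempty [J] cannot contain [J], and
    only size [d] forces [j] in. *)
Lemma exists_avoiding_set (d : nat) (J : {set 'I_d}) (h : 'I_d.+1) :
  (0 < #|J|)%N ->
  exists B : {set 'I_d}, #|B| = h /\ (J \subset B) = (h == ord_max).
Proof.
case/card_gt0P => j jJ; have [->|hd] := eqVneq h ord_max.
  by exists setT; rewrite cardsT card_ord subsetT.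
(* Without [j] there remain d - 1 indices, enough for [h] elements since [h] is not d. *)
have [|B BC Bh] := @subset_of_card _ (~: [set j]) h.
  have := cardsC [set j]; rewrite cards1 card_ord add1n => jd.
  by rewrite -ltnS jd ltn_neqAle -ltnS ltn_ord andbT.
exists B; split=> //; apply/negP => /subsetP /(_ j jJ) jB.
by have := subsetP BC j jB; rewrite !inE eqxx.
Qed.

(** Serves the upper bound: if [h] is large enough, [J] is padded with elements of its complement;
    otherwise cardinality alone rules out inclusion. *)
Lemma exists_containing_set (d : nat) (J : {set 'I_d}) (h : 'I_d.+1) :
  exists B : {set 'I_d}, #|B| = h /\ (J \subset B) = (#|J| <= h)%N.
Proof.
have [Jh|hJ] := leqP #|J| h.
  have [|B BC Bh] := @subset_of_card _ (~: J) (h - #|J|).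
    by rewrite leq_subLR cardsC card_ord -ltnS.
  exists (J :|: B); split; last exact: subsetUl.
  rewrite cardsU Bh subnKC //; suff -> : J :&: B = set0 by rewrite cards0 subn0.
  by apply/eqP; rewrite setI_eq0 disjoint_sym disjoints_subset.
have [B _ Bh] := subset_of_card (ltnW hJ).
exists B; split=> //; apply/negP => /subset_leq_card.
by rewrite Bh leqNgt hJ.
Qed.

(** The witness is the image of the law [p] under the map sending [h] to the indicator vector of
    [B h]; since [B h] has [h] elements, the coordinate sum recovers [h]. *)
Lemma in_class_of_sets (R : realFieldType) (d : nat) (p : {ffun 'I_d.+1 -> R})
    (B : 'I_d.+1 -> {set 'I_d}) (J : {set 'I_d}) :
  is_pmf p -> (forall h, #|B h| = h) ->
  exists f : {ffun binvec d -> R},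
    in_class p f /\ cross_moment f J = \sum_(h | J \subset B h) p h.
Proof.
move=> [p0 p1] Bh; pose v h : binvec d := [ffun i => i \in B h].
pose f : {ffun binvec d -> R} := [ffun x => \sum_(h | v h == x) p h].
(* Image-measure formula; total mass, level masses and the moment are all instances of it. *)
have probE (A : pred (binvec d)) : prob f A = \sum_(h | A (v h)) p h.
  rewrite (partition_big v A) //; apply: eq_bigr => x Ax; rewrite ffunE.
  by apply: eq_bigl => h; case: eqP => [->|]; rewrite ?Ax ?andbF.
have vs h : support_set (v h) = B h by apply: support_set_indicator.
exists f; split; last first.
  by rewrite cross_moment_prob probE; apply: eq_bigl => h /=; rewrite vs.
split; first split.
- by move=> x; rewrite ffunE sumr_ge0.
- by have := probE predT; rewrite /prob /= p1.
- move=> h; rewrite probE (big_pred1 h) // => h' /=.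
  by rewrite coord_sum_card vs Bh.
Qed.

Theorem proposition2p1 (R : realFieldType) (d : nat) (hd : (1 <= d)%N)
    (p : {ffun 'I_d.+1 -> R}) (hp : is_pmf p)
    (k : nat) (hk : (1 <= k)%N) (J : {set 'I_d}) (hJ : #|J| = k) :
  (forall f : {ffun binvec d -> R}, in_class p f ->
     p ord_max <= cross_moment f J /\
     cross_moment f J <= \sum_(h < d.+1 | (k <= h)%N) p h) /\
  (exists f : {ffun binvec d -> R},
     in_class p f /\ cross_moment f J = p ord_max) /\
  (exists f : {ffun binvec d -> R},
     in_class p f /\ cross_moment f J = \sum_(h < d.+1 | (k <= h)%N) p h).
Proof.
subst k; split; [|split].
- move=> f pf; have [[f0 _] fp] := pf; rewrite cross_moment_prob; split.
    (* [p ord_max] is the mass of the vectors with coordinate sum [d], whose support is everything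
       and so contains [J]. *)
    rewrite -fp; apply: prob_le => // x /= /eqP; rewrite coord_sum_card => xd.
    have /eqP -> : support_set x == setT.
      by rewrite eqEcard subsetT cardsT card_ord xd leqnn.
    exact: subsetT.
  rewrite -(prob_coord_sum (fun n => (#|J| <= n)%N) pf).
  by apply: prob_le => // x /= /subset_leq_card; rewrite coord_sum_card.
(* Finite choice turns the separate sets into one family [B]; only [h = ord_max] then contributes to
   the moment. *)
- have /fin_all_exists [B HB] := fun h => exists_avoiding_set h hk.
  have [f [pf fJ]] := in_class_of_sets J hp (fun h => (HB h).1).
  exists f; split=> //; rewrite fJ (big_pred1 ord_max) // => h.
  by rewrite (HB h).2.
- have /fin_all_exists [B HB] := exists_containing_set J.
  have [f [pf fJ]] := in_class_of_sets J hp (fun h => (HB h).1).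
  by exists f; split=> //; rewrite fJ; apply: eq_bigl => h; rewrite (HB h).2.
Qed.
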